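(* Let $(\Phi,\Delta)$ be a based root system in $(V,B)$ with $\Delta$ a basis of $V$. Let $(\rho_n)_{n\in\mathbb{N}}$ be an injective sequence of positive roots (elements of $\Phi^+$), and suppose that the sequence of normalized roots $(\widehat{\rho_n})_{n\in\mathbb N}$ converges to a limit $\ell$. Then: (i) $\|\rho_n\|$ tends to infinity (for any norm $\|\cdot\|$ on $V$); (ii) the limit $\ell$ lies in $\widehat{Q}=Q\cap V_1$. In other words, the set of accumulation points of the set of normalized roots $\widehat{\Phi}$ is contained in the isotropic cone $Q$.
   Context: Let $V$ be a finite-dimensional real vector space with a symmetric bilinear form $B$. For $\alpha\in V$ with $B(\alpha,\alpha)\neq 0$, let $s_\alpha(v)=v-2\frac{B(\alpha,v)}{B(\alpha,\alpha)}\alpha$ for $v\in V$. A simple system is a finite subset $\Delta\subset V$ such that: (1) $\Delta$ is positively independent (if $\sum_{\alpha\in\Delta}\lambda_\alpha\alpha=0$ with all $\lambda_\alpha\ge 0$ then all $\lambda_\alpha=0$); (2) for distinct $\alpha,\beta\in\Delta$, $B(\alpha,\beta)\in(-\infty,-1]\cup\{-\cos(\pi/k): k\in\mathbb{Z}_{\ge 2}\}$; (3) $B(\alpha,\alpha)=1$ for all $\alpha\in\Delta$. Let $W$ be the subgroup of the orthogonal group $O_B(V)$ generated by $S=\{s_\alpha:\alpha\in\Delta\}$ and $\Phi=W(\Delta)$ the orbit of $\Delta$. The pair $(\Phi,\Delta)$ is called a based root system in $(V,B)$; $(W,S)$ is a Coxeter system. Let $\mathrm{cone}(\Delta)$ be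 the set of nonnegative linear combinations of $\Delta$ and $\Phi^+=\Phi\cap\mathrm{cone}(\Delta)$ the set of positive roots; then $\Phi=\Phi^+\sqcup(-\Phi^+)$. Standing assumption: $\Delta$ is a basis of $V$. For $v=\sum_{\alpha\in\Delta}v_\alpha\alpha$ put $|v|_1=\sum_{\alpha\in\Delta}v_\alpha$ (not a norm), $V_0=\{v:|v|_1=0\}$, $V_1=\{v:|v|_1=1\}$. For $v\in V\setminus V_0$ put $\widehat v=v/|v|_1\in V_1$. One has $\Phi\cap V_0=\emptyset$, and $\widehat\Phi=\{\widehat\rho:\rho\in\Phi\}=\{\widehat\rho:\rho\in\Phi^+\}$ is the set of normalized roots. Its accumulation points are the limits of convergent injective sequences of elements of $\widehat\Phi$. Put $q(v)=B(v,v)$, and let $Q=\{v\in V: q(v)=0\}$ be the isotropic cone. *)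

(* Defs.v *)
From HB Require Import structures.
From mathcomp Require Import all_boot all_order all_algebra finmap.
From mathcomp Require Import all_classical all_reals all_analysis.

Set Implicit Arguments.
Unset Strict Implicit.
Unset Printing Implicit Defensive.

Import Order.TTheory GRing.Theory Num.Theory.
Import numFieldNormedType.Exports.

Local Open Scope classical_set_scope.
Local Open Scope ring_scope.

(* Finite-dimensional normed spaces. All the norms on a finite-dimensional real
   vector space induce the same topology, so the norm carried by the structure
   only serves to express convergence in the usual topology of the space. *)
#[short(type="normedVectType")]
HB.structure Definition NormedVector (R : numFieldType) :=
  {V of NormedModule R V & Vector R V}.

Section BasedRootSystem.
Variables (R : realType) (V : vectType R).
Implicit Types (B : {symmetric V}) (Phi : set V) (Delta : {fset V}) (v : V).

Definition is_norm (N : V -> R) : Prop :=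
  [/\ forall u v, N (u + v) <= N u + N v,
      forall (c : R) v, N (c *: v) = `|c| * N v &
      forall v, N v = 0 -> v = 0].

Definition reflection B (a v : V) : V := v - (2 * (B a v / B a a)) *: a.

Fact reflection_is_linear B a : linear (reflection B a).
Proof.
move=> k u v; rewrite /reflection linearPr /=.
set x := B a u; set y := B a v; set c := B a a.
have -> : 2 * ((k * x + y) / c) = k * (2 * (x / c)) + 2 * (y / c).
  by rewrite (mulrDl (k * x)) (mulrDr 2) -mulrA (mulrCA 2).
by rewrite scalerDl -(scalerA k) scalerBr opprD addrACA.
Qed.

HB.instance Definition _ B (a : V) :=
  GRing.isLinear.Build R V V *:%R (reflection B a) (reflection_is_linear B a).

Definition positively_independent Delta : Prop :=
  forall lam : V -> R, (forall a, a \in Delta -> 0 <= lam a) ->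
    \sum_(a <- Delta) lam a *: a = 0 -> forall a, a \in Delta -> lam a = 0.

Definition simple_system B Delta : Prop :=
  [/\ positively_independent Delta,
      forall a b, a \in Delta -> b \in Delta -> a != b ->
        B a b <= -1 \/ (exists2 k : nat, (2 <= k)%N & B a b = - cos (pi / k%:R)) &
      forall a, a \in Delta -> B a a = 1].

(* In finite dimension, an endomorphism with trivial kernel is invertible. *)
Definition orthogonal_group B : set 'End(V) :=
  [set f | lker f = 0%VS /\ forall u v, B (f u) (f v) = B u v].

Definition orthogonal_subgroup B (H : set 'End(V)) : Prop :=
  [/\ H `<=` orthogonal_group B,
      H \1%VF,
      forall f g, H f -> H g -> H (f \o g)%VF &
      forall f, H f -> H (f^-1)%VF].

Definition simple_reflections B Delta : set 'End(V) :=
  [set linfun (reflection B a) | a in [set` Delta]].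

Definition reflection_group B Delta : set 'End(V) :=
  smallest (orthogonal_subgroup B) (simple_reflections B Delta).

Definition roots B Delta : set V :=
  [set (w : 'End(V)) a | w in reflection_group B Delta & a in [set` Delta]].

Definition based_root_system B Phi Delta : Prop :=
  simple_system B Delta /\ Phi = roots B Delta.

Definition cone Delta : set V :=
  [set v | exists2 lam : V -> R, (forall a, a \in Delta -> 0 <= lam a) &
           v = \sum_(a <- Delta) lam a *: a].

Definition positive_roots Phi Delta : set V := Phi `&` cone Delta.

(* Meaningful when Delta is a basis of V. *)
Definition coord_sum Delta v : R :=
  \sum_(i < size (enum_fset Delta)) coord (in_tuple (enum_fset Delta)) i v.

Definition V1 Delta : set V := [set v | coord_sum Delta v = 1].

(* Meaningful when coord_sum Delta v != 0; otherwise it is 0. *)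
Definition normalize Delta v : V := (coord_sum Delta v)^-1 *: v.

Definition isotropic_cone B : set V := [set v | B v v = 0].

End BasedRootSystem.

Definition accumulation_points (T : topologicalType) (A : set T) : set T :=
  [set l | exists u : nat -> T,
             [/\ injective u, forall n, A (u n) & u @ \oo --> l]].

(* Main.v *)
Require Import Defs.
From mathcomp Require Import all_boot all_order all_algebra finmap.
From mathcomp Require Import all_classical all_reals all_analysis.
From mathcomp Require Import ring lra zify.
From HB Require Import structures.

Import Order.TTheory GRing.Theory Num.Theory.
Import numFieldNormedType.Exports.

Local Open Scope classical_set_scope.
Local Open Scope ring_scope.

(** A root satisfies q(rho) = 1, so the normalized root rho / |rho|_1 satisfies
    q = 1 / |rho|_1 ^ 2.  Both claims therefore reduce to one fact: only
    finitely many positive roots have a coordinate sum below a given bound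
    (finite_bounded_roots).  An injective sequence of positive roots then has
    |rho_n|_1 tending to infinity; every norm dominates a multiple of the l1
    norm of coordinates (norm1_le_norm), which gives (i), and q of the limit is
    the limit of 1 / |rho_n|_1 ^ 2, which gives (ii).

    The finiteness expresses that the reflection group is discrete.  If a group
    element moves every simple root a by so little that its image keeps a
    positive coordinate sum, then all these images are positive roots, and an
    element with this property is the identity (act_eq_id).  When x and y are
    positive roots in a bounded region and x - y is small, the product of
    reflections s_x s_y is of this kind, because s_x s_x = 1; hence s_x = s_y
    and x = y (close_roots_eq).  So the roots in a bounded region are uniformly
    separated, and a pigeonhole argument on a grid bounds their number.

    What remains is the classical theory behind act_eq_id: each root is positive
    or negative, and a shortest word ending in a sends the simple root a to a
    negative root (act_sign, shortest_rcons).  Group elements are handled as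
    words in the simple roots.  The key statement is act_simple_cone: if
    appending the letter a does not allow a shorter expression of the shortest
    word s, then s maps a to a positive root.  By induction on the length, s is
    written as v followed by an alternating word in a and the last letter of s,
    with v as short as possible; v then maps both letters to positive roots, and
    the alternating word maps a to a combination of these two letters whose
    coefficients are values of Chebyshev polynomials at - B(a, b).  These are
    nonnegative when - B(a, b) >= 1.  When - B(a, b) = cos(pi / m) they are
    nonnegative as long as the alternating word is shorter than m; length at
    least m is excluded by the braid relation (braid), which would let the word
    end in a. *)

(** * Chebyshev polynomials at cos (pi / m) *)

Section Chebyshev.
Set Implicit Arguments.
Unset Strict Implicit.
Variable R : realType.
Implicit Types (c t : R) (k m : nat).

(** Chebyshev polynomials of the second kind, with the index shifted by one so
    that chebU (cos t) k = sin (k t) / sin t. *)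
Fixpoint chebU c k : R :=
  match k with
  | 0 => 0
  | 1 => 1
  | (k'.+1 as k1).+1 => 2 * c * chebU c k1 - chebU c k'
  end.

Lemma chebUSS c k : chebU c k.+2 = 2 * c * chebU c k.+1 - chebU c k.
Proof. by []. Qed.

Lemma sin_chebU t k : sin t * chebU (cos t) k = sin (k%:R * t).
Proof.
suff: sin t * chebU (cos t) k = sin (k%:R * t) /\
      sin t * chebU (cos t) k.+1 = sin (k.+1%:R * t) by case.
elim: k => [|k [IH0 IH1]].
  by rewrite /= mul0r sin0 mulr0 mulr1 mul1r.
split=> //; rewrite chebUSS mulrBr IH0 mulrCA IH1.
have -> : k.+2%:R * t = k.+1%:R * t + t by rewrite -(natr1 k.+1) mulrDl mul1r.
have -> : k%:R * t = k.+1%:R * t - t.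
  by rewrite -(natr1 k) mulrDl mul1r addrK.
by rewrite sinB sinD; ring.
Qed.

(** For c >= 1 the recurrence makes the sequence nondecreasing. *)
Lemma chebU_ge0 c k : 1 <= c -> 0 <= chebU c k.
Proof.
move=> c1; suff: 0 <= chebU c k <= chebU c k.+1 by case/andP.
elim: k => [|k /andP[h0 h1]]; first by rewrite /= lexx ler01.
apply/andP; split; first exact: le_trans h1.
by rewrite chebUSS; nra.
Qed.

Lemma sin_pi_div_gt0 m : (2 <= m)%N -> 0 < sin (pi / m%:R : R).
Proof.
move=> m2; have m0 : 0 < m%:R :> R by rewrite ltr0n; lia.
apply: sin_gt0_pi; rewrite divr_gt0 ?pi_gt0 //=.
by rewrite ltr_pdivrMr // ltr_pMr ?pi_gt0 // ltr1n.
Qed.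

Lemma chebU_pi_eq0 m : (2 <= m)%N -> chebU (cos (pi / m%:R)) m = 0.
Proof.
move=> m2; have s0 := sin_pi_div_gt0 m2.
apply: (mulfI (lt0r_neq0 s0)).
by rewrite mulr0 sin_chebU mulrC divfK ?sinpi // pnatr_eq0; lia.
Qed.

Lemma chebU_pi_ge0 m k : (2 <= m)%N -> (k <= m)%N ->
  0 <= chebU (cos (pi / m%:R)) k.
Proof.
move=> m2 km; have s0 := sin_pi_div_gt0 m2.
rewrite -(pmulr_rge0 _ s0) sin_chebU.
have m0 : 0 < m%:R :> R by rewrite ltr0n; lia.
apply: sin_ge0_pi; rewrite mulr_ge0 ?ler0n ?divr_ge0 ?pi_ge0 ?ler0n //=.
by rewrite mulrCA ler_piMr ?pi_ge0 // ler_pdivrMr // mul1r ler_nat.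
Qed.

End Chebyshev.

(** * Words of reflections *)

Section Words.
Set Implicit Arguments.
Unset Strict Implicit.
Variables (R : realType) (V : vectType R) (B : {symmetric V}).
Implicit Types (a b u v w : V) (s : seq V).

Lemma sform_sym u v : B u v = B v u.
Proof. by rewrite hermC /= expr0 mul1r. Qed.

Lemma sformZl k u v : B (k *: u) v = k * B u v.
Proof. exact: linearZl_LR. Qed.

Lemma sformZr k u v : B u (k *: v) = k * B u v.
Proof. by rewrite sform_sym sformZl sform_sym. Qed.

Lemma sformBl u v w : B (u - v) w = B u w - B v w.
Proof. exact: linearBl. Qed.

Lemma sformBr u v w : B w (u - v) = B w u - B w v.
Proof. exact: linearBr. Qed.

Lemma sformDr u v w : B w (u + v) = B w u + B w v.
Proof. exact: linearDr. Qed.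

Lemma sform_suml I (r : seq I) (f : I -> V) v :
  B (\sum_(i <- r) f i) v = \sum_(i <- r) B (f i) v.
Proof. exact: linear_sumlz. Qed.

Lemma sform_sumr I (r : seq I) (f : I -> V) v :
  B v (\sum_(i <- r) f i) = \sum_(i <- r) B v (f i).
Proof. exact: linear_sumr. Qed.

Lemma reflectionE a v : B a a = 1 -> reflection B a v = v - (2 * B a v) *: a.
Proof. by move=> aa; rewrite /reflection aa divr1. Qed.

Lemma reflection_isometry a u v : B a a = 1 ->
  B (reflection B a u) (reflection B a v) = B u v.
Proof.
move=> aa; rewrite !reflectionE // sformBl !sformBr !(sformZl, sformZr) aa.
by rewrite (sform_sym u a); ring.
Qed.

Lemma reflectionK a : B a a = 1 -> involutive (reflection B a).
Proof.
move=> aa v; rewrite !reflectionE // sformBr sformZr aa.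
rewrite -addrA -opprD -scalerDl.
have -> : 2 * B a v + 2 * (B a v - 2 * B a v * 1) = 0 by ring.
by rewrite scale0r subr0.
Qed.

Lemma reflectionN a : B a a = 1 -> reflection B a a = - a.
Proof.
move=> aa; rewrite reflectionE // aa mulr1 scaler_nat mulr2n opprD addrA subrr.
by rewrite sub0r.
Qed.

Definition act s v : V := foldr (reflection B) v s.

Fact act_is_linear s : linear (act s).
Proof. by elim: s => [|a s IH] k u v /=; [|rewrite IH linearP]. Qed.
HB.instance Definition _ s :=
  GRing.isLinear.Build R V V *:%R (act s) (act_is_linear s).

Lemma act_cat s s' v : act (s ++ s') v = act s (act s' v).
Proof. by rewrite /act foldr_cat. Qed.

Lemma act_rcons s a v : act (rcons s a) v = act s (reflection B a v).
Proof. by rewrite -cats1 act_cat. Qed.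

Lemma act_cancel s s' a v : B a a = 1 ->
  act (rcons s a ++ a :: s') v = act (s ++ s') v.
Proof. by move=> aa; rewrite !act_cat act_rcons /= reflectionK. Qed.

Lemma act_isometry s u v : {in s, forall a, B a a = 1} ->
  B (act s u) (act s v) = B u v.
Proof.
elim: s => //= a s IH s1; rewrite reflection_isometry ?s1 ?mem_head // IH //.
by move=> b bs; rewrite s1 // inE bs orbT.
Qed.

Lemma act_rcons_unit s a v : B a a = 1 ->
  act (rcons s a) v = act s v - (2 * B a v) *: act s a.
Proof. by move=> aa; rewrite act_rcons reflectionE // linearB linearZ. Qed.

End Words.

(** * Alternating words in two reflections *)

Section Dihedral.
Set Implicit Arguments.
Unset Strict Implicit.
Variables (R : realType) (V : vectType R) (B : {symmetric V}).
Variable (e : bool -> V).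
Hypothesis e1 : forall i, B (e i) (e i) = 1.
Let c := - B (e true) (e false).

(** The two letters are indexed by booleans, so that i (+) odd k is the letter
    that would continue the alternating word of length k starting with i. *)
Fixpoint alt i k := if k is k'.+1 then e i :: alt (~~ i) k' else [::].

Lemma size_alt i k : size (alt i k) = k.
Proof. by elim: k i => //= k IH i; rewrite IH. Qed.

Lemma alt_rcons i k : alt i k.+1 = rcons (alt i k) (e (i (+) odd k)).
Proof.
elim: k i => [|k IH] i; first by rewrite /= addbF.
by rewrite [LHS]/= -/(alt (~~ i) k.+1) IH /= addbN addNb.
Qed.

Lemma alt_cat i k l : alt i (k + l) = alt i k ++ alt (i (+) odd k) l.
Proof.
elim: k i => [|k IH] i; first by rewrite /= addbF.
by rewrite addSn /= IH addbN addNb.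
Qed.

Lemma form_alt i : B (e i) (e (~~ i)) = - c.
Proof. by rewrite /c opprK; case: i => //=; rewrite sform_sym. Qed.

(** In the plane spanned by the two letters, prepending a letter to the word
    amounts to one step of the Chebyshev recurrence. *)
Lemma act_alt i k : act B (alt i k) (e (i (+) odd k)) =
  chebU c k.+1 *: e i + chebU c k *: e (~~ i).
Proof.
elim: k i => [|k IH] i; first by rewrite /= addbF scale1r scale0r addr0.
have -> : i (+) odd k.+1 = ~~ i (+) odd k by rewrite /= addbN addNb.
rewrite [LHS]/= IH negbK reflectionE // sformDr !sformZr e1 form_alt chebUSS.
rewrite -!addrA -scalerBl addrC.
by congr (_ *: _ + _); ring.
Qed.

(** Expanding the last reflection of both words gives, by act_alt, a telescoping
    recurrence for the difference. *)
Lemma act_alt_sub i k v : act B (alt i k) v - act B (alt (~~ i) k) v =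
  (- (2 * chebU c k * B (e (~~ i (+) odd k)) v)) *: e i
  + (2 * chebU c k * B (e (i (+) odd k)) v) *: e (~~ i).
Proof.
elim: k => [|k IH]; first by rewrite /= mulr0 !mul0r oppr0 !scale0r subrr addr0.
have -> : i (+) odd k.+1 = ~~ i (+) odd k by rewrite /= addbN addNb.
have -> : ~~ i (+) odd k.+1 = i (+) odd k by rewrite /= addbN addNb negbK.
have comb (a b s t x y : R) (p q : V) :
    a *: p + b *: q + (- (s *: (x *: p + y *: q)) + t *: (x *: q + y *: p)) =
    (a - s * x + t * y) *: p + (b - s * y + t * x) *: q.
  rewrite !scalerDr !scalerA opprD [t * x *: q + _]addrC.
  rewrite (addrACA (- _)) (addrACA (a *: p)).
  by rewrite -!scaleNr -!scalerDl -!addrA.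
rewrite !alt_rcons !act_rcons_unit // opprD addrACA IH !act_alt negbK opprK comb.
by congr (_ *: _ + _ *: _); ring.
Qed.

(** For c = cos (pi / m) this is the relation s t s ... = t s t ... of the finite
    dihedral group of order 2 m; it holds on all of V because chebU c m is a
    factor of the whole difference in act_alt_sub. *)
Lemma braid i m : chebU c m = 0 -> act B (alt i m) =1 act B (alt (~~ i) m).
Proof.
move=> U0 v; apply/eqP; rewrite -subr_eq0 act_alt_sub U0.
by rewrite mulr0 !mul0r oppr0 !scale0r addr0.
Qed.

End Dihedral.

(** * The cone of positive combinations *)

Section Cone.
Set Implicit Arguments.
Unset Strict Implicit.
Variables (R : realType) (V : vectType R) (Delta : {fset V}).
Implicit Types (a u v : V) (k : R).

Lemma coneD u v : cone Delta u -> cone Delta v -> cone Delta (u + v).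
Proof.
move=> [f f0 ->] [g g0 ->]; exists (fun a => f a + g a) => [a aD|].
  by rewrite addr_ge0 ?f0 ?g0.
by rewrite -big_split; apply: eq_bigr => a _; rewrite scalerDl.
Qed.

Lemma coneZ k v : 0 <= k -> cone Delta v -> cone Delta (k *: v).
Proof.
move=> k0 [f f0 ->]; exists (fun a => k * f a) => [a aD|].
  by rewrite mulr_ge0 ?f0.
by rewrite scaler_sumr; apply: eq_bigr => a _; rewrite scalerA.
Qed.

Lemma cone_simple a : a \in Delta -> cone Delta a.
Proof.
move=> aD; exists (fun b => (b == a)%:R) => [b _|]; first exact: ler0n.
rewrite (bigD1_seq a) ?fset_uniq //= eqxx scale1r big1 ?addr0 // => b /negPf ->.
by rewrite scale0r.
Qed.

Lemma cone_opp_eq0 v : positively_independent Delta ->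
  cone Delta v -> cone Delta (- v) -> v = 0.
Proof.
move=> indep [f f0 vf] [g g0 vg].
have fg : \sum_(a <- Delta) (f a + g a) *: a = 0.
  under eq_bigr do rewrite scalerDl.
  by rewrite big_split /= -vf -vg subrr.
have {}fg := indep (fun a => f a + g a) (fun a aD => addr_ge0 (f0 a aD) (g0 a aD)) fg.
rewrite vf big_seq big1 // => a aD.
have := fg a aD; have := f0 a aD; have := g0 a aD => /= ga fa fga.
have fa0 : f a = 0 by lra.
by rewrite fa0 scale0r.
Qed.

End Cone.

(** * Positive and negative roots *)

Section Positivity.
Set Implicit Arguments.
Unset Strict Implicit.
Variables (R : realType) (V : vectType R) (B : {symmetric V}).
Variable Delta : {fset V}.
Hypothesis simple : simple_system B Delta.
Implicit Types (a b v : V) (s t : seq V).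

Definition word s := all (fun a => a \in Delta) s.

Lemma word_cat s t : word (s ++ t) = word s && word t.
Proof. exact: all_cat. Qed.

Lemma word_rcons s a : word (rcons s a) = (a \in Delta) && word s.
Proof. exact: all_rcons. Qed.

Definition shortest s :=
  forall t, word t -> act B t =1 act B s -> (size s <= size t)%N.

Lemma simple_unit a : a \in Delta -> B a a = 1.
Proof. by case: simple => _ _; exact. Qed.

Lemma word_unit s : word s -> {in s, forall a, B a a = 1}.
Proof. by move=> /allP sD a /sD; exact: simple_unit. Qed.

Lemma exists_shortest s : word s ->
  exists t, [/\ word t, act B t =1 act B s & shortest t].
Proof.
have [n] := ubnP (size s); elim: n s => // n IH s sn ws.
have [short|] := pselect (shortest s); first by exists s.
move=> /existsNP[t /not_implyP[wt /not_implyP[ts /negP]]]; rewrite -ltnNge => ltts.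
have [//|t' [wt' t't st']] := IH t _ wt; first by lia.
by exists t'; split=> // v; rewrite t't ts.
Qed.

(** The inductive core of the theory of Coxeter groups: if s cannot be
    re-expressed by a shorter word after multiplication by the reflection in a,
    then s maps a to a positive root.  Comparing with the length of
    s itself, rather than requiring a longer word, spares the argument that
    multiplication by a reflection changes the parity of the length. *)
Lemma act_simple_cone s a : word s -> shortest s -> a \in Delta ->
  (forall t, word t -> act B t =1 act B (rcons s a) -> (size s <= size t)%N) ->
  cone Delta (act B s a).
Proof.
have [n] := ubnP (size s); elim: n s a => // n IH s a.
case/lastP: s => [|s0 b] sn; first by move=> *; exact: cone_simple.
rewrite word_rcons => /andP[bD ws0]; set s := rcons s0 b.
move=> shs aD longer; set e := fun i : bool => if i then a else b.
have eD i : e i \in Delta by case: i.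
have e1 i : B (e i) (e i) = 1 by exact: simple_unit.
have walt i k : word (alt e i k) by elim: k i => //= k IHk i; rewrite eD IHk.
have catE t t' v : act B (t ++ t') v = act B t (act B t' v) by exact: act_cat.
have cancel t j l u :
    act B (rcons t (e j)) (act B (alt e j l.+1) u) = act B (t ++ alt e (~~ j) l) u.
  by rewrite -catE; exact: act_cancel.
have sz_s : size s = (size s0).+1 by rewrite size_rcons.
have ab : a != b.
  apply/eqP => ab; have : (size s <= size s0)%N; last by rewrite sz_s ltnn.
  apply: longer => // v.
  by rewrite /s -ab !act_rcons reflectionK // (e1 true).
(* Among the factorizations of s ending in an alternating word of length k in
   the letters a and b, choose one with k maximal. *)
pose P k := exists (v : seq V) (i : bool), [/\ word v, (size v + k = size s)%N &
                           act B (v ++ alt e i k) =1 act B s].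
have P1 : P 1%N by exists s0, false; split=> //; rewrite ?sz_s ?addn1 ?cats1.
have [k Pk kmax] : exists2 k, P k & forall j, P j -> (j <= k)%N.
  have exP : exists k, `[<P k>] by exists 1%N; apply/asboolP.
  have ubP k : `[<P k>] -> (k <= size s)%N.
    by move=> /asboolP[v [i [_ <- _]]]; rewrite leq_addl.
  case: (ex_maxnP exP ubP) => k /asboolP Pk kmax; exists k => // j Pj.
  by apply: kmax; apply/asboolP.
have := kmax _ P1; case: k Pk kmax => // k [v [i [wv vk vs]]] kmax _.
(* The prefix v inherits the hypothesis for both letters: shortening v followed
   by a letter would either shorten s or lengthen its alternating suffix. *)
have v_longer j t :
    word t -> act B t =1 act B (rcons v (e j)) -> (size v <= size t)%N.
  move=> wt tv; rewrite leqNgt; apply/negP => lt_tv.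
  have [ij|ij] := eqVneq j i.
    have : (size s <= size (t ++ alt e (~~ i) k))%N.
      apply: shs => [|u]; first by rewrite word_cat wt /= walt.
      by rewrite -vs !catE tv -catE ij cat_rcons.
    by rewrite size_cat size_alt; lia.
  have {}ij : j = ~~ i by case: (i) (j) ij => [] [].
  have st : (size s <= size (t ++ alt e j k.+2))%N.
    apply: shs => [|u]; first by rewrite word_cat wt walt.
    by rewrite -vs catE tv cancel ij negbK.
  have : P k.+2.
    exists t, j; split=> //; first by move: st; rewrite size_cat size_alt; lia.
    by move=> u; rewrite -vs catE tv cancel ij negbK.
  by move/kmax; rewrite ltnn.
have shv : shortest v.
  move=> t wt tv; have : (size s <= size (t ++ alt e i k.+1))%N.
    apply: shs => [|u]; first by rewrite word_cat wt walt.
    by rewrite -vs !catE tv.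
  by rewrite size_cat size_alt; lia.
have v_cone j : cone Delta (act B v (e j)).
  apply: IH => //; last exact: v_longer.
  by move: sn; rewrite -/s -vk; lia.
(* If the suffix ended in a, appending a to s would cancel this letter and give
   a word shorter than s. *)
have no_a_end t : word t -> size t = k -> ~ act B (v ++ rcons t a) =1 act B s.
  move=> wt tk ts; have : (size s <= size (v ++ t))%N.
    apply: longer => [|u]; first by rewrite word_cat wv.
    rewrite [RHS]act_rcons -[RHS]ts -rcons_cat [RHS]act_rcons reflectionK //.
    exact: (e1 true).
  by rewrite size_cat; lia.
have i_end : i (+) odd k.+1.
  rewrite /= addbN; apply/negP => ik; apply: (no_a_end (alt e i k)) => //.
    exact: size_alt.
  by move=> u; rewrite -vs alt_rcons ik.
pose c := - B (e true) (e false).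
have ba : act B s a =
    chebU c k.+2 *: act B v (e i) + chebU c k.+1 *: act B v (e (~~ i)).
  rewrite -vs catE -linearZ -linearZ -linearD; congr (act B v _).
  by rewrite -[X in chebU X]/c -(act_alt e1) i_end.
suff [U1 U2] : 0 <= chebU c k.+2 /\ 0 <= chebU c k.+1.
  by rewrite ba; apply: coneD; apply: coneZ.
have [_ /(_ a b aD bD ab) Bab _] := simple.
case: Bab => [Bab|[m m2 Bab]].
  by split; apply: chebU_ge0; rewrite /c /= lerNr.
have {}cE : c = cos (pi / m%:R) by rewrite /c Bab opprK.
have [km|mk] := ltnP k.+1 m.
  by rewrite cE; split; apply: chebU_pi_ge0 => //; exact: ltnW.
have U0 : chebU c m = 0 by rewrite cE chebU_pi_eq0.
case: m m2 mk U0 {Bab cE} => // m m2 mk U0.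
case: (no_a_end (alt e i (k - m) ++ alt e (~~ (i (+) odd (k - m))) m)) => //.
- by rewrite word_cat !walt.
- by rewrite size_cat !size_alt; lia.
move=> u; rewrite -vs.
have {1}-> : k.+1 = (k - m + m.+1)%N by lia.
(* With m.+1 the order of s_a s_b, the braid relation applied to the last m.+1
   letters makes the word end in a. *)
have e_end : ~~ (i (+) odd (k - m)) (+) odd m.
  by move: i_end; rewrite -{1}(subnK (mk : (m <= k)%N)) /= oddD addbN addNb addbA.
by rewrite alt_cat rcons_cat !catE (braid e1 _ U0) alt_rcons e_end.
Qed.

(** The prefix s satisfies the hypothesis of act_simple_cone, and the final
    reflection changes the sign of a. *)
Lemma shortest_rcons s a : word (rcons s a) -> shortest (rcons s a) ->
  cone Delta (- act B (rcons s a) a).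
Proof.
rewrite word_rcons => /andP[aD ws] short; have aa := simple_unit aD.
rewrite act_rcons reflectionN // linearN opprK.
apply: act_simple_cone => // t wt ts.
  have := short (rcons t a); rewrite word_rcons aD wt !size_rcons ltnS; apply=> // v.
  by rewrite !act_rcons ts.
by have := short t wt ts; rewrite size_rcons; exact: ltnW.
Qed.

(** If act_simple_cone does not apply to s, it applies to a shortest word for
    s followed by the reflection in a, which sends a to the opposite root. *)
Lemma act_sign s a : word s -> a \in Delta ->
  cone Delta (act B s a) \/ cone Delta (- act B s a).
Proof.
move=> ws aD; have aa := simple_unit aD.
have [s' [ws' s's short]] := exists_shortest ws; rewrite -s's.
have [longer|] := pselect (forall t, word t -> act B t =1 act B (rcons s' a) ->
    (size s' <= size t)%N).
  by left; exact: act_simple_cone.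
move=> /existsNP[t0 /not_implyP[wt0 /not_implyP[t0s /negP]]]; rewrite -ltnNge => lt0.
have [t [wt tt0 sht]] := exists_shortest wt0; right.
have ts v : act B t v = act B s' (reflection B a v) by rewrite tt0 t0s act_rcons.
have -> : - act B s' a = act B t a by rewrite ts reflectionN // linearN.
apply: act_simple_cone => // u wu ut.
have lt_t : (size t <= size t0)%N by exact: sht.
apply: leq_trans (ltnW (leq_ltn_trans lt_t lt0)) (short u wu _) => v.
by rewrite ut act_rcons ts reflectionK.
Qed.

(** A nonempty shortest word would send its last letter a both to a positive and
    to a negative vector, hence to 0, although B(a, a) = 1 is preserved. *)
Lemma act_eq_id s : word s -> (forall a, a \in Delta -> cone Delta (act B s a)) ->
  act B s =1 id.
Proof.
move=> ws s_pos; have [t [wt ts sht]] := exists_shortest ws.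
case/lastP: t wt ts sht => [|t a] wt ts sht; first by move=> v; rewrite -ts.
have aD : a \in Delta by move: wt; rewrite word_rcons => /andP[].
have indep : positively_independent Delta by case: simple.
have ta0 : act B (rcons t a) a = 0.
  by apply: (cone_opp_eq0 indep) => //; [rewrite ts; exact: s_pos | exact: shortest_rcons].
have := act_isometry a a (word_unit wt).
rewrite ta0 (simple_unit aD) linear0r => /eqP.
by rewrite eq_sym oner_eq0.
Qed.

End Positivity.

(** * Coordinates in the basis of simple roots *)

Section Coordinates.
Set Implicit Arguments.
Unset Strict Implicit.
Variables (R : realType) (V : vectType R) (Delta : {fset V}).
Hypothesis basis : basis_of fullv (enum_fset Delta).
Implicit Types (a u v x y : V).

Local Notation n := (size (enum_fset Delta)).
Local Notation X := (in_tuple (enum_fset Delta)).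

Definition norm1 v : R := \sum_(i < n) `|coord X i v|.

Lemma basis_expand v : v = \sum_(i < n) coord X i v *: X`_i.
Proof. exact: (@coord_basis _ _ fullv _ X v basis (memvf v)). Qed.

Lemma coord_nth (i j : 'I_n) : coord X j X`_i = (i == j)%:R.
Proof. exact: (@coord_free _ _ _ X i j (basis_free basis)). Qed.

Lemma cone_coord_ge0 v (i : 'I_n) : cone Delta v -> 0 <= coord X i v.
Proof.
move=> [f f0 ->]; rewrite (big_nth 0) big_mkord.
rewrite (coord_sum_free (fun j : 'I_n => f X`_j)); last exact: basis_free basis.
by apply: f0; rewrite mem_nth.
Qed.

Fact coord_sum_is_scalar : linear_for *%R (coord_sum Delta).
Proof.
move=> k u v; rewrite /coord_sum mulr_sumr -big_split.
by apply: eq_bigr => i _; rewrite linearP.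
Qed.
HB.instance Definition _ :=
  GRing.isLinear.Build R V R *%R (coord_sum Delta) coord_sum_is_scalar.

Lemma coord_sumB u v :
  coord_sum Delta (u - v) = coord_sum Delta u - coord_sum Delta v.
Proof. exact: linearB. Qed.

Lemma coord_sumZ k v : coord_sum Delta (k *: v) = k * coord_sum Delta v.
Proof. exact: linearZ. Qed.

Lemma norm1_ge0 v : 0 <= norm1 v.
Proof. exact: sumr_ge0. Qed.

Lemma coord_le_norm1 v (i : 'I_n) : `|coord X i v| <= norm1 v.
Proof. by rewrite /norm1 (bigD1 i) //= lerDl sumr_ge0. Qed.

Lemma coord_sum_le_norm1 v : `|coord_sum Delta v| <= norm1 v.
Proof. exact: ler_norm_sum. Qed.

Lemma norm1_cone v : cone Delta v -> norm1 v = coord_sum Delta v.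
Proof. by move=> vpos; apply: eq_bigr => i _; rewrite ger0_norm ?cone_coord_ge0. Qed.

Lemma norm1_eq0 v : norm1 v = 0 -> v = 0.
Proof.
move=> v0; rewrite [v]basis_expand big1 // => i _.
have := coord_le_norm1 v i; rewrite v0 normr_le0 => /eqP ->.
by rewrite scale0r.
Qed.

Lemma coord_sum_simple a : a \in Delta -> coord_sum Delta a = 1.
Proof.
move=> aD; have ia : (index a (enum_fset Delta) < n)%N by rewrite index_mem.
have aX : a = X`_(Ordinal ia) by rewrite /= nth_index.
rewrite /coord_sum (bigD1 (Ordinal ia)) //= [X in coord _ _ X]aX.
rewrite coord_nth eqxx big1 ?addr0 // => i ne.
by rewrite aX coord_nth eq_sym (negPf ne).
Qed.

Lemma norm1_simple a : a \in Delta -> norm1 a = 1.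
Proof. by move=> aD; rewrite norm1_cone ?coord_sum_simple //; exact: cone_simple. Qed.

Lemma form_bound (B : {symmetric V}) :
  exists2 K : R, 0 <= K & forall u v, `|B u v| <= K * norm1 u * norm1 v.
Proof.
exists (\sum_(i < n) \sum_(j < n) `|B X`_i X`_j|).
  by apply: sumr_ge0 => i _; exact: sumr_ge0.
move=> u v; rewrite {1}[u]basis_expand {1}[v]basis_expand.
rewrite sform_suml mulr_suml mulr_suml.
apply: le_trans (ler_norm_sum _ _ _) _; apply: ler_sum => i _.
rewrite sform_sumr mulr_suml mulr_suml.
apply: le_trans (ler_norm_sum _ _ _) _; apply: ler_sum => j _.
rewrite sformZl sformZr !normrM mulrA mulrC -[leRHS]mulrA.
apply: ler_wpM2l => //.
by apply: ler_pM => //; exact: coord_le_norm1.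
Qed.

End Coordinates.

(** * Separation of positive roots *)

Section Discreteness.
Set Implicit Arguments.
Unset Strict Implicit.
Variables (R : realType) (V : vectType R) (B : {symmetric V}).
Variable Delta : {fset V}.
Hypothesis simple : simple_system B Delta.
Hypothesis basis : basis_of fullv (enum_fset Delta).
Implicit Types (a v x y : V) (s : seq V).

(** Positive roots, with the group elements replaced by words. *)
Definition positive_root : set V :=
  [set act B s a | s in word Delta & a in [set` Delta]] `&` cone Delta.

Lemma act_rev s v : {in s, forall a, B a a = 1} ->
  act B s (act B (rev s) v) = v.
Proof.
elim/last_ind: s v => //= s a IH v s1.
rewrite rev_rcons act_rcons /= reflectionK ?s1 ?mem_rcons ?mem_head //.
by rewrite IH // => b bs; rewrite s1 // mem_rcons inE bs orbT.
Qed.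

Lemma root_unit x : positive_root x -> B x x = 1.
Proof.
move=> [[s ws [a aD <-]] _].
rewrite act_isometry; [exact: simple_unit aD | exact: word_unit ws].
Qed.

(** The reflection in w a is the conjugate w s_a w^-1. *)
Lemma root_reflection x : positive_root x ->
  exists2 s, word Delta s & reflection B x =1 act B s.
Proof.
move=> xr; have xx := root_unit xr; case: xr xx => -[s ws [a aD <-]] _ xx.
have s1 := word_unit simple ws; have aa := simple_unit simple aD.
exists (s ++ a :: rev s) => [|v].
  by rewrite word_cat ws /word /= aD all_rev.
rewrite act_cat /= [in RHS]reflectionE // linearB linearZ /=.
rewrite act_rev //.
by rewrite reflectionE // -{2}[v](act_rev v s1) act_isometry.
Qed.

(** The image of a simple root is positive or negative, and its coordinate sum
    decides which; so s_x s_y preserves positivity and is the identity.  Equal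
    reflections force y = x or y = - x, and the latter is not positive. *)
Lemma root_eq x y : positive_root x -> positive_root y ->
  (forall a, a \in Delta -> 0 < coord_sum Delta (reflection B x (reflection B y a))) ->
  x = y.
Proof.
move=> xr yr pos; have xx := root_unit xr; have yy := root_unit yr.
have [sx wx xE] := root_reflection xr; have [sy wy yE] := root_reflection yr.
have xy_id : act B (sx ++ sy) =1 id.
  have wxy : word Delta (sx ++ sy) by rewrite word_cat wx.
  apply: (act_eq_id simple wxy) => a aD.
  have [//|neg] := act_sign simple wxy aD.
  have := norm1_ge0 Delta (- act B (sx ++ sy) a).
  by rewrite norm1_cone // linearN oppr_ge0 leNgt act_cat -xE -yE pos.
have xy v : reflection B x v = reflection B y v.
  by rewrite -{1}(reflectionK yy v) xE yE -act_cat xy_id.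
have yx : y = B x y *: x.
  have h := xy y; rewrite reflectionN // reflectionE // in h.
  have n2 : 2 != 0 :> R by rewrite pnatr_eq0.
  apply: (scalerI n2); rewrite scalerA; apply/eqP.
  by rewrite -subr_eq0 scaler_nat mulr2n -addrA h subrr.
have : B x y ^+ 2 == 1.
  by rewrite -[X in _ == X]yy [in X in _ == X]yx sformZl sformZr xx mulr1.
rewrite sqrf_eq1 => /orP[/eqP xy1|/eqP xy1]; first by rewrite yx xy1 scale1r.
have x0 : x = 0.
  have indep : positively_independent Delta by case: simple.
  apply: (cone_opp_eq0 indep); first by case: xr.
  by rewrite -scaleN1r -xy1 -yx; case: yr.
by move: xx; rewrite x0 linear0r => /eqP; rewrite eq_sym oner_eq0.
Qed.

(** With d = x - y and B(x, y) = 1 - q(d) / 2, the coordinate sum of s_x s_y a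
    differs from 1 by terms that all contain a factor d.  The constant 1 / 8
    bounds them by 1/4 + 1/4 + 1/32 < 1. *)
Lemma close_roots_eq K M x y : 0 <= K ->
  (forall u v, `|B u v| <= K * norm1 Delta u * norm1 Delta v) ->
  positive_root x -> positive_root y ->
  norm1 Delta x <= M -> norm1 Delta y <= M ->
  K * M * norm1 Delta (x - y) <= 8^-1 -> x = y.
Proof.
move=> K0 Bb xr yr xM yM xyM; apply: root_eq => // a aD.
have xx := root_unit xr; have yy := root_unit yr.
set d := x - y in xyM.
have Bxy : B x y = 1 - B d d / 2.
  have : B d d = B x x - 2 * B x y + B y y.
    by rewrite /d sformBl !sformBr (sform_sym B y x); ring.
  by rewrite xx yy => ->; field.
set sg := coord_sum Delta.
have -> : sg (reflection B x (reflection B y a)) =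
   1 + 2 * B y a * sg d - 2 * B d a * sg x - 2 * B y a * B d d * sg x.
  have dE : d = x - y by [].
  rewrite !reflectionE // sformBr sformZr Bxy /sg !(coord_sumB, coord_sumZ).
  rewrite coord_sum_simple // [in 2 * B d a]dE sformBl.
  by field.
have Ba u : `|B u a| <= K * norm1 Delta u.
  by have := Bb u a; rewrite (norm1_simple basis aD) mulr1.
have nd := norm1_ge0 Delta d; have nx := norm1_ge0 Delta x.
have ny := norm1_ge0 Delta y.
have sgd : `|sg d| <= norm1 Delta d by exact: coord_sum_le_norm1.
have sgx : `|sg x| <= M by apply: le_trans xM; exact: coord_sum_le_norm1.
have Bya : `|B y a| <= K * M by apply: le_trans (Ba y) _; rewrite ler_wpM2l.
have M0 : 0 <= M by apply: le_trans xM.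
have KM0 : 0 <= K * M by rewrite mulr_ge0.
have e1 : `|B y a * sg d| <= 8^-1.
  by rewrite normrM; apply: le_trans xyM; apply: ler_pM.
have e2 : `|B d a * sg x| <= 8^-1.
  rewrite normrM; apply: le_trans xyM; rewrite mulrAC; exact: ler_pM.
have e3 : `|B y a * B d d * sg x| <= 64^-1.
  rewrite !normrM -mulrA.
  have -> : 64^-1 = 8^-1 * 8^-1 :> R by field.
  apply: (@le_trans _ _ ((K * M) * ((K * norm1 Delta d * norm1 Delta d) * M))).
    by rewrite ler_pM ?mulr_ge0 //; apply: ler_pM.
  have -> : K * M * (K * norm1 Delta d * norm1 Delta d * M) =
    (K * M * norm1 Delta d) * (K * M * norm1 Delta d) by ring.
  by apply: ler_pM => //; rewrite mulr_ge0.
move: e1 e2 e3; rewrite !ler_norml => /andP[e1 _] /andP[_ e2] /andP[_ e3].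
lra.
Qed.

End Discreteness.

(** * Finiteness of bounded sets of positive roots *)

Section Finiteness.
Set Implicit Arguments.
Unset Strict Implicit.
Variables (R : realType) (V : vectType R) (B : {symmetric V}).
Variable Delta : {fset V}.
Hypothesis simple : simple_system B Delta.
Hypothesis basis : basis_of fullv (enum_fset Delta).

(** The coordinates of these roots lie in [0, M].  Cutting this interval into
    pieces of length 1 / N, with N chosen so that two roots in the same cell are
    equal by close_roots_eq, injects the roots into a finite type. *)
Lemma finite_bounded_roots M :
  finite_set [set x | positive_root B Delta x /\ norm1 Delta x <= M].
Proof.
have [K K0 KB] := form_bound basis B.
pose n := size (enum_fset Delta).
pose c (i : 'I_n) x := coord (in_tuple (enum_fset Delta)) i x.
pose N := (Num.truncn (8 * (K * M) * n%:R)).+1.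
pose cell x (i : 'I_n) := Num.truncn (c i x * N%:R).
pose T := Num.truncn (M * N%:R).
pose f x := [ffun i => inord (cell x i) : 'I_T.+1].
set A := [set x | _].
have c_ge0 x i : A x -> 0 <= c i x by move=> [[_ xc] _]; exact: cone_coord_ge0.
have N0 : 0 < N%:R :> R by rewrite ltr0n.
have cell_le x i : A x -> (cell x i < T.+1)%N.
  move=> Ax; rewrite ltnS; apply: le_truncn; rewrite ler_pM2r //.
  apply: le_trans (ler_norm _) (le_trans (coord_le_norm1 _ _) _).
  by case: Ax.
have f_inj : {in A &, injective f}.
  move=> x y; rewrite !inE => Ax Ay fxy.
  have [[xr xM] [yr yM]] := (Ax, Ay).
  have M0 : 0 <= M by apply: le_trans xM; exact: norm1_ge0.
  have near i : `|c i (x - y)| <= N%:R^-1.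
    have cxy : cell x i = cell y i.
      by have /ffunP/(_ i)/(congr1 val) := fxy; rewrite !ffunE /= !inordK ?cell_le.
    have cx0 : 0 <= c i x * N%:R by rewrite mulr_ge0 ?c_ge0 // ler0n.
    have cy0 : 0 <= c i y * N%:R by rewrite mulr_ge0 ?c_ge0 // ler0n.
    have /andP[x1 x2] := truncn_itv cx0; have /andP[y1 y2] := truncn_itv cy0.
    move: x1 x2 y1 y2; rewrite -/(cell x i) -/(cell y i) -cxy -natr1 => x1 x2 y1 y2.
    have -> : c i (x - y) = (c i x * N%:R - c i y * N%:R) / N%:R.
      by rewrite /c linearB /= -mulrBl mulfK // lt0r_neq0.
    rewrite normrM normfV (gtr0_norm N0) ler_piMl ?invr_ge0 ?ler0n //.
    by rewrite ler_norml; lra.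
  apply: (close_roots_eq simple basis K0 KB xr yr xM yM).
  have norm_xy : norm1 Delta (x - y) <= n%:R / N%:R.
    apply: (@le_trans _ _ (\sum_(i < n) N%:R^-1)).
      by apply: ler_sum => i _; exact: near.
    by rewrite sumr_const card_ord -[leLHS]mulr_natl.
  apply: le_trans (ler_wpM2l (mulr_ge0 K0 M0) norm_xy) _.
  rewrite mulrA ler_pdivrMr //.
  have KMn0 : 0 <= 8 * (K * M) * n%:R by rewrite !mulr_ge0.
  by have /andP[_ ] := truncn_itv KMn0; rewrite -/N; lra.
by rewrite -(eq_finite_set (inj_card_eq f_inj)); exact: finite_finset.
Qed.

Lemma injective_finite_eventually (T : eqType) (u : nat -> T) (A : set T) :
  injective u -> finite_set A -> \forall n \near \oo, ~ A (u n).
Proof.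
move=> u_inj finA.
have /finite_seqP[s sE] : finite_set (u @^-1` A).
  by apply: finite_preimage => // m n _ _; exact: u_inj.
exists (\max_(i <- s) i).+1 => // n /= sn An.
have : n \in s by have : (u @^-1` A) n by []; rewrite sE.
by move=> /leq_bigmax_seq/(_ isT)/(leq_trans sn); rewrite ltnn.
Qed.

Lemma norm1_root_cvgy (rho : nat -> V) : injective rho ->
  (forall n, positive_root B Delta (rho n)) ->
  norm1 Delta (rho n) @[n --> \oo] --> +oo.
Proof.
move=> rho_inj rho_root; apply/cvgryPge => M.
have := injective_finite_eventually rho_inj (finite_bounded_roots M).
apply: filterS => n /= nM; rewrite leNgt; apply/negP => lt_nM.
by apply: nM; split=> //; exact: ltW.
Qed.

End Finiteness.

(** * Comparison of norms *)

Section Norms.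
Set Implicit Arguments.
Unset Strict Implicit.
Variables (R : realType) (V : vectType R) (Delta : {fset V}).
Hypothesis basis : basis_of fullv (enum_fset Delta).

Lemma is_norm_ge0 (N : V -> R) v : is_norm N -> 0 <= N v.
Proof.
move=> [ND NZ _].
have N0 : N 0 = 0 by rewrite -[X in N X](scale0r 0) NZ normr0 mul0r.
have := ND v (- v); rewrite subrr N0 -scaleN1r NZ normrN normr1 mul1r.
by lra.
Qed.

Lemma is_norm_sum (N : V -> R) I (r : seq I) (f : I -> V) : is_norm N ->
  N (\sum_(i <- r) f i) <= \sum_(i <- r) N (f i).
Proof.
move=> [ND NZ _]; elim: r => [|i r IH].
  by rewrite !big_nil -[X in N X](scale0r 0) NZ normr0 mul0r.
by rewrite !big_cons; apply: le_trans (ND _ _) _; rewrite lerD2l.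
Qed.

Lemma rV_coord_le_norm n (x : 'rV[R]_n) i : `|x ord0 i| <= `|x|.
Proof.
rewrite [leRHS]/Num.Def.normr /= mx_normrE; apply/bigmax_geP; right => /=.
by exists (ord0, i).
Qed.

(** In coordinates, N is a continuous function on the row vectors and has a
    positive minimum on the compact unit sphere of the max norm. *)
Lemma norm1_le_norm (N : V -> R) : is_norm N ->
  exists2 C, 0 < C & forall v, norm1 Delta v <= C * N v.
Proof.
move=> Nnorm; have [ND NZ N0] := Nnorm.
pose n := size (enum_fset Delta); pose X := in_tuple (enum_fset Delta).
pose vec (x : 'rV[R]_n) := \sum_i x ord0 i *: X`_i.
pose row v : 'rV[R]_n := \row_i coord X i v.
have rowK v : vec (row v) = v.
  by rewrite [RHS](basis_expand basis); apply: eq_bigr => i _; rewrite mxE.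
have vecB x y : vec (x - y) = vec x - vec y.
  by rewrite /vec -sumrB; apply: eq_bigr => i _; rewrite !mxE scalerBl.
have vecDB x y : vec x + vec (y - x) = vec y.
  by rewrite vecB addrCA subrr addr0.
have vecZ k x : vec (k *: x) = k *: vec x.
  by rewrite /vec scaler_sumr; apply: eq_bigr => i _; rewrite mxE scalerA.
pose L := \sum_(i < n) N X`_i.
have L0 : 0 <= L by apply: sumr_ge0 => i _; exact: is_norm_ge0.
have NL x : N (vec x) <= L * `|x|.
  apply: le_trans (is_norm_sum _ _ Nnorm) _; rewrite mulr_suml.
  apply: ler_sum => i _; rewrite NZ mulrC ler_wpM2l ?is_norm_ge0 //.
  exact: rV_coord_le_norm.
pose S := [set x : 'rV[R]_n | `|x| = 1].
have cont : continuous (N \o vec).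
  move=> x; apply/(@cvgrPdist_le _ _ _ (nbhs x) (nbhs_filter x)) => e e0.
  near=> y => /=.
  apply: (@le_trans _ _ (L * `|x - y|)).
    rewrite ler_norml; apply/andP; split.
      have := ND (vec x) (vec (y - x)); have := NL (y - x).
      by rewrite vecDB distrC; lra.
    have := ND (vec y) (vec (x - y)); have := NL (x - y).
    by rewrite vecDB; lra.
  apply: (@le_trans _ _ ((L + 1) * `|x - y|)).
    by rewrite ler_wpM2r // lerDl.
  rewrite mulrC -ler_pdivlMr; last by lra.
  near: y; apply: cvgr_dist_le; first exact: cvg_id.
  by rewrite divr_gt0 //; lra.
have Scpt : compact S.
  apply: bounded_closed_compact.
    by exists 1; split=> // y y1 x /= ->; exact: ltW.
  have -> : S = Num.norm @^-1` [set 1] by [].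
  by apply: closed_comp; [move=> x _; exact: norm_continuous | exact: closed_eq].
(* The sphere is empty exactly when V is trivial. *)
have [[x0 Sx0]|S0] := pselect (S !=set0); last first.
  exists 1 => // v; suff -> : v = 0.
    by rewrite /norm1 big1 ?mul1r ?is_norm_ge0 // => i _; rewrite linear0 normr0.
  have [->|rv0] := eqVneq v 0; first by [].
  exfalso; apply: S0; exists (`|row v|^-1 *: row v).
  rewrite /S /= normrZ normfV normr_id mulVf // normr_eq0.
  by apply: contra_neq rv0 => rv0; rewrite -[v]rowK rv0 -(scale0r (0 : 'rV_n)) vecZ scale0r.
have [x xS xmin] := EVT_min_rV (ex_intro _ x0 Sx0) Scpt (continuous_subspaceT cont).
rewrite inE /S /= in xS.
have m0 : 0 < N (vec x).
  rewrite lt_neqAle is_norm_ge0 // andbT eq_sym; apply/eqP => /N0 vx0.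
  suff x00 : x = 0 by move: xS; rewrite x00 normr0 => /eqP; rewrite eq_sym oner_eq0.
  apply/rowP => i; rewrite mxE.
  have <- := @coord_sum_free _ _ _ X (x ord0) i (basis_free basis).
  by rewrite -/(vec x) vx0 linear0.
pose m := N (vec x).
have mN v : m * `|row v| <= N v.
  have [->|rv0] := eqVneq (row v) 0; first by rewrite normr0 mulr0 is_norm_ge0.
  have rv_gt0 : 0 < `|row v| by rewrite normr_gt0.
  have : m <= N (vec (`|row v|^-1 *: row v)).
    apply: xmin; rewrite inE /S /= normrZ normfV normr_id mulVf //.
    by rewrite normr_eq0.
  by rewrite vecZ rowK NZ normfV normr_id mulrC ler_pdivlMr.
exists ((n%:R + 1) / m) => [|v]; first by rewrite divr_gt0 // ltr_wpDl.
apply: (@le_trans _ _ (n%:R * `|row v|)).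
  apply: (@le_trans _ _ (\sum_(i < n) `|row v|)).
    apply: ler_sum => i _.
    by have := rV_coord_le_norm (row v) i; rewrite mxE.
  by rewrite sumr_const card_ord -[leLHS]mulr_natl.
rewrite -mulrA; apply: (@le_trans _ _ ((n%:R + 1) * `|row v|)).
  by rewrite ler_wpM2r // lerDl.
by rewrite ler_wpM2l ?addr_ge0 // mulrC ler_pdivlMr // mulrC.
Unshelve. all: by end_near.
Qed.

End Norms.

(** * Limits of normalized roots *)

Section Limits.
Set Implicit Arguments.
Unset Strict Implicit.
Variables (R : realType) (V : normedVectType R) (B : {symmetric V}).
Variable Delta : {fset V}.
Hypothesis simple : simple_system B Delta.
Hypothesis basis : basis_of fullv (enum_fset Delta).

(** As q is continuous, q(l) is the limit of q of the normalized roots, which is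
    the squared inverse of their l1 norm; likewise the coordinate sum of l is the
    limit of a sequence of ones.  Both are made explicit by bounds in terms of
    the l1 distance z n to the limit. *)
Lemma normalize_limit (rho : nat -> V) (l : V) : injective rho ->
  (forall n, positive_root B Delta (rho n)) ->
  normalize Delta (rho n) @[n --> \oo] --> l ->
  (isotropic_cone B `&` V1 Delta) l.
Proof.
move=> rho_inj rho_root rho_l.
have rho_y := norm1_root_cvgy simple basis rho_inj rho_root.
have rho_cone n : cone Delta (rho n) by case: (rho_root n).
pose r n := (norm1 Delta (rho n))^-1.
have r0 : r n @[n --> \oo] --> (0 : R).
  by apply/gtr0_cvgV0 => //; near=> n; near: n; move/cvgryPgt: rho_y; apply.
pose v n := normalize Delta (rho n).
have normal : is_norm (fun u : V => `|u|).
  split=> [u w|c u|u]; [exact: ler_normD | exact: normrZ | exact: normr0_eq0].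
have [C C0 CN] := norm1_le_norm basis normal.
pose z n := norm1 Delta (v n - l).
have z0 : z n @[n --> \oo] --> (0 : R).
  apply: (@squeeze_cvgr _ _ _ _ (fun=> 0) (fun n => C * `|v n - l|)).
  - by apply: nearW => n; rewrite norm1_ge0 CN.
  - exact: cvg_cst.
  - rewrite -(mulr0 C); apply: cvgMr; rewrite -(normr0 V) -(subrr l).
    by apply: cvg_norm; apply: cvgB => //; exact: cvg_cst.
have [K K0 KB] := form_bound basis B.
split.
  pose b n := r n ^+ 2 + 2 * K * norm1 Delta l * z n + K * z n ^+ 2.
  have b0 : b n @[n --> \oo] --> (0 : R).
    have -> : 0 = 0 ^+ 2 + 2 * K * norm1 Delta l * 0 + K * 0 ^+ 2 :> R.
      by rewrite expr2 !mulr0 !addr0.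
    by apply: cvgD; [apply: cvgD|]; try apply: cvgMr; rewrite ?expr2; try apply: cvgM.
  apply/eqP; rewrite -normr_le0; apply: (cvgr_to_ge b0); apply: nearW => n.
  have qv : B (v n) (v n) = r n ^+ 2.
    by rewrite sformZl sformZr (root_unit simple) // mulr1 -expr2 /r norm1_cone.
  have := KB l (v n - l); have := KB (v n - l) (v n - l).
  have -> : B l l = B (v n) (v n) - 2 * B l (v n - l) - B (v n - l) (v n - l).
    by rewrite sformBl !sformBr (sform_sym B (v n) l); ring.
  rewrite qv -/(z n) => h1 h2.
  apply: le_trans (ler_normB _ _) _.
  apply: le_trans (lerD (ler_normB _ _) (lexx _)) _.
  rewrite (ger0_norm (sqr_ge0 _)) normrM (ger0_norm (ler0n _ 2)) /b.
  by lra.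
have v1 n : coord_sum Delta (v n) = 1.
  have := norm1_cone basis (rho_cone n) => e.
  rewrite coord_sumZ mulVf // -e; apply/eqP => /(norm1_eq0 basis) rho0.
  have := root_unit simple (rho_root n); rewrite rho0 linear0r => /eqP.
  by rewrite eq_sym oner_eq0.
apply/eqP; rewrite eq_sym -subr_eq0 -normr_le0; apply: (cvgr_to_ge z0).
apply: nearW => n; rewrite -(v1 n) -coord_sumB; exact: coord_sum_le_norm1.
Unshelve. all: by end_near.
Qed.

Lemma norm_root_cvgy (rho : nat -> V) (N : V -> R) : injective rho ->
  (forall n, positive_root B Delta (rho n)) -> is_norm N ->
  N (rho n) @[n --> \oo] --> +oo.
Proof.
move=> rho_inj rho_root Nnorm; have [C C0 CN] := norm1_le_norm basis Nnorm.
apply/cvgryPge => M; have /cvgryPge/(_ (C * M)) :=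
  norm1_root_cvgy simple basis rho_inj rho_root.
by apply: filterS => n Mn; rewrite -(ler_pM2l C0); exact: le_trans (CN _).
Qed.

(** The endomorphisms given by words form an orthogonal subgroup that contains
    the simple reflections. *)
Lemma roots_words x : Defs.roots B Delta x ->
  exists s a, [/\ word Delta s, a \in Delta & x = act B s a].
Proof.
pose H : set 'End(V) := [set f : 'End(V) | exists2 s, word Delta s & f =1 act B s].
have HW : reflection_group B Delta `<=` H.
  apply: smallest_sub => [|_ [a aD <-]]; last first.
    by exists [:: a] => [|u]; [rewrite /word /= andbT | rewrite lfunE].
  split.
  - move=> f [s ws fs]; have s1 := word_unit simple ws.
    split=> [|u w]; last by rewrite !fs act_isometry.
    apply/eqP; rewrite -subv0; apply/subvP => u; rewrite memv_ker memv0 fs => /eqP su0.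
    have s1' : {in rev s, forall a, B a a = 1} by move=> a; rewrite mem_rev; exact: s1.
    by have := act_rev u s1'; rewrite revK su0 linear0 => <-.
  - by exists [::] => // u; rewrite id_lfunE.
  - move=> f g [s ws fs] [t wt gt]; exists (s ++ t); first by rewrite word_cat ws.
    by move=> u; rewrite lfunE /= gt fs act_cat.
  - move=> f [s ws fs]; have s1 := word_unit simple ws.
    have s1' : {in rev s, forall a, B a a = 1} by move=> a; rewrite mem_rev; exact: s1.
    exists (rev s) => [|u]; first by rewrite /word all_rev.
    have f_inj : lker f == 0%VS.
      apply/lker0P => w w'; rewrite !fs => /(congr1 (act B (rev s))).
      by have K u' := act_rev u' s1'; rewrite revK in K; rewrite !K.
    by rewrite -{1}(act_rev u s1) -fs lker0_lfunK.
move=> [w /HW[s ws wE] [a aD <-]]; exists s, a; split=> //; exact: wE.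
Qed.

End Limits.

Theorem theorem2p7 (R : realType) (V : normedVectType R) (B : {symmetric V})
    (Phi : set V) (Delta : {fset V}) :
  based_root_system B Phi Delta ->
  basis_of fullv (enum_fset Delta) ->
  (forall (rho : nat -> V) (l : V),
     injective rho ->
     (forall n, positive_roots Phi Delta (rho n)) ->
     normalize Delta (rho n) @[n --> \oo] --> l ->
     (forall N : V -> R, is_norm N -> N (rho n) @[n --> \oo] --> +oo) /\
     (isotropic_cone B `&` V1 Delta) l) /\
  accumulation_points (normalize Delta @` Phi) `<=` isotropic_cone B.
Proof.
move=> [simple ->] basis.
have pos_root x : positive_roots (Defs.roots B Delta) Delta x -> positive_root B Delta x.
  move=> [/(roots_words simple)[s [a [ws aD ->]]] sa_pos].
  by split=> //; exists s => //; exists a.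
split=> [rho l rho_inj rho_pos rho_l|l [u [u_inj uPhi ul]]].
  have rho_root n := pos_root _ (rho_pos n).
  split=> [N Nnorm|]; first exact: (norm_root_cvgy simple basis rho_inj rho_root).
  exact: (normalize_limit simple basis rho_inj rho_root).
(* A root and its opposite have the same normalization, so positive
   representatives can be chosen. *)
have /choice[rho rhoP] : forall n, exists x,
    positive_root B Delta x /\ normalize Delta x = u n.
  move=> n; have [x /(roots_words simple)[s [a [ws aD ->]]] <-] := uPhi n.
  have [pos|neg] := act_sign simple ws aD.
    by exists (act B s a); split=> //; split=> //; exists s => //; exists a.
  have aa := simple_unit simple aD.
  have E : act B (rcons s a) a = - act B s a.
    by rewrite act_rcons reflectionN // linearN.
  exists (- act B s a); split.
    by split=> //; exists (rcons s a); [rewrite word_rcons aD | exists a].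
  rewrite /normalize.
  have -> : coord_sum Delta (- act B s a) = - coord_sum Delta (act B s a).
    exact: linearN.
  by rewrite invrN scaleNr scalerN opprK.
have rho_inj : injective rho.
  by move=> i j rij; apply: u_inj; rewrite -(rhoP i).2 -(rhoP j).2 rij.
have ul' : normalize Delta (rho n) @[n --> \oo] --> l.
  have -> : (fun n => normalize Delta (rho n)) = u.
    by apply/funext => n; exact: (rhoP n).2.
  exact: ul.
by have [] := normalize_limit simple basis rho_inj (fun n => (rhoP n).1) ul'.
Qed.
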